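(* Assume that $T$ is a rising tree with discriminator $D\ne4$ or a progressing tree, and let $\Phi$ be its encoding function. Let $\beta=[b_0,b_1,b_2,\dots]=[0,1,2^{1\cdot1},2^{2\cdot3},2^{3\cdot193},\dots]$ be the irrational number defined recursively by $b_0=0$, $b_1=1$ and $b_{j+1}=2^{j\cdot v_j}$ for $j\ge1$, where $u_j/v_j=[b_0,b_1,\dots,b_j]$ is the $j$th convergent in lowest terms. Then there exists a sequence $x_j\to0$ such that for every $B>0$ (arbitrarily large), $$\left|\Phi(x_j+\beta)-\Phi(\beta)-\Phi'(\beta)x_j\right|>B\,|x_j|^2$$ for all sufficiently large $j$.
   Context: All fractions $k/n$ are in lowest terms with $n\ge1$. Two fractions $a/b<c/d$ in $[0,1]$ are Farey neighbours if $bc-ad=1$; their mediant is $(a+c)/(b+d)$. Each $q\in\mathbb Q\cap(0,1)$ is the mediant of a unique pair of Farey neighbours in $[0,1]$, denoted $q_0<q_0'$. $[b_0,b_1,\dots]$ denotes a standard continued fraction. A real Markov tree $T$ with base triple $(s_0,u_0,t_0)\in\mathbb R^3$ is a rooted planar trivalent tree (the root has degree 1, all other vertices degree 3) whose complementary regions carry real labels; the root edge has the region $s_0$ on its left, $t_0$ on its right, and leads to the region $u_0$; and for every non-root edge, with regions $s,t$ on its two sides and $r,u$ at its two ends, $r+u=st$. The regions are Farey-indexed by $\mathbb Q\cap[0,1]$, writing $m_q=m(T)_q$: $m_0=s_0$, $m_{1/2}=u_0$, $m_1=t_0$, and for each $q\in\mathbb Q\cap(0,1)$, if $p$ is the mediant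 of $q_0,q$ and $p'$ the mediant of $q,q_0'$, then $m_p=m_{q_0}m_q-m_{q_0'}$ and $m_{p'}=m_qm_{q_0'}-m_{q_0}$. The non-root vertices correspond to $q\in\mathbb Q\cap(0,1)$: the regions $q_0,q,q_0'$ meet at vertex $q$. Let $e_q$ be the edge at vertex $q$ on the side of the root. It is (positively) directed away from the root if $2m_q-m_{q_0}m_{q_0'}>0$, towards the root if this is negative, and undirected if it is $0$. The discriminator is $D=s_0^2+u_0^2+t_0^2-s_0u_0t_0$. $T$ is a rising tree if all labels are $>2$ and all edges are positively directed away from the root except for those on a finite (possibly empty) simple path starting at the root. $T$ is a progressing tree if $2\le s_0<u_0$, $2\le t_0<u_0$ and $(s_0-2)(t_0-2)=0$. The encoding function $\Phi=\Phi_T:[0,1]\to\mathbb R_{\ge0}$ is the unique continuous function with $m_{k/n}=2\cosh(n\Phi(k/n))$ for all $k/n\in\mathbb Q\cap[0,1]$; it exists for rising and progressing trees and is differentiable at every irrational in $(0,1)$. *)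

(* Defs.v *)
From HB Require Import structures.
From mathcomp Require Import all_boot all_order all_algebra.
From mathcomp Require Import all_classical all_reals all_analysis.

Set Implicit Arguments.
Unset Strict Implicit.
Unset Printing Implicit Defensive.

Import Order.TTheory GRing.Theory Num.Theory.
Import numFieldNormedType.Exports.

Local Open Scope ring_scope.
Local Open Scope classical_set_scope.

Definition farey_neighbours (p q : rat) : bool :=
  [&& 0 <= p, p < q, q <= 1 & denq p * numq q - numq p * denq q == 1].

Definition mediant (p q : rat) : rat :=
  (numq p + numq q)%:Q / (denq p + denq q)%:Q.

(** [farey_vertex q0 q q0']: the regions meeting at the vertex [q] are
    [q0 < q < q0']. *)
Definition farey_vertex (q0 q q0' : rat) : Prop :=
  farey_neighbours q0 q0' /\ q = mediant q0 q0'.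

(** The planar tree is the same for all base triples, so a Markov tree is given
    by the labels of its regions; [label T q] is irrelevant for [q] outside
    [0, 1]. *)
Record markov_tree (R : realType) := MarkovTree {
  base_s : R;
  base_u : R;
  base_t : R;
  label : rat -> R;
  label_0 : label 0 = base_s;
  label_half : label 2^-1 = base_u;
  label_1 : label 1 = base_t;
  label_left : forall q0 q q0' : rat, farey_vertex q0 q q0' ->
    label (mediant q0 q) = label q0 * label q - label q0';
  label_right : forall q0 q q0' : rat, farey_vertex q0 q q0' ->
    label (mediant q q0') = label q * label q0' - label q0
}.

Definition discriminator (R : realType) (T : markov_tree R) : R :=
  base_s T ^+ 2 + base_u T ^+ 2 + base_t T ^+ 2
  - base_s T * base_u T * base_t T.

(** The edge [e_q] joining the vertex [q] to its predecessor is identified with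
    [q]; [e_(1/2)] is the root edge. *)
Definition directed_away (R : realType) (T : markov_tree R)
    (q0 q q0' : rat) : bool :=
  0 < 2 * label T q - label T q0 * label T q0'.

Definition child_vertex (q p : rat) : Prop :=
  exists q0 q0' : rat,
    farey_vertex q0 q q0' /\ (p = mediant q0 q \/ p = mediant q q0').

(** A simple path starting at the root can never turn back, so it is the list of
    the edges [e_q] it descends, beginning with the root edge unless empty. *)
Definition root_path (s : seq rat) : Prop :=
  ((0 < size s)%N -> s`_0 = 2^-1) /\
  (forall i : nat, (i.+1 < size s)%N -> child_vertex s`_i s`_i.+1).

Definition rising_tree (R : realType) (T : markov_tree R) : Prop :=
  (forall q : rat, 0 <= q <= 1 -> 2 < label T q) /\
  (exists s : seq rat, root_path s /\
     forall q0 q q0' : rat, farey_vertex q0 q q0' ->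
       directed_away T q0 q q0' = (q \notin s)).

Definition progressing_tree (R : realType) (T : markov_tree R) : Prop :=
  [/\ 2 <= base_s T < base_u T, 2 <= base_t T < base_u T &
      (base_s T - 2) * (base_t T - 2) = 0].

Definition cosh (R : realType) (x : R) : R := (expR x + expR (- x)) / 2.

(** Only the values of [Phi] on [0, 1] matter. *)
Definition encoding_function (R : realType) (T : markov_tree R)
    (Phi : R -> R) : Prop :=
  [/\ {within `[0, 1], continuous Phi},
      (forall x : R, 0 <= x <= 1 -> 0 <= Phi x) &
      (forall q : rat, 0 <= q <= 1 ->
         label T q = 2 * cosh ((denq q)%:~R * Phi (ratr q)))].

(** [cfrac [:: b0; ...; bj]] is the finite continued fraction [b0, ..., bj];
    the last step relies on [0^-1 = 0]. *)
Fixpoint cfrac (s : seq nat) : rat :=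
  if s is b :: s' then b%:R + (cfrac s')^-1 else 0.

(** [beta_terms j] is [:: b_0; ...; b_j], where [v_j] is the reduced
    denominator of the convergent [b_0, ..., b_j]. *)
Fixpoint beta_terms (j : nat) : seq nat :=
  match j with
  | 0 => [:: 0%N]
  | i.+1 =>
    let s := beta_terms i in
    rcons s (if i == 0%N then 1%N else (2 ^ (i * `|denq (cfrac s)|))%N)
  end.

Definition beta (R : realType) : R :=
  limn (fun j => ratr (cfrac (beta_terms j)) : R).

(* Main.v *)
(** For a Farey pair [(p, q)] with mediant [r] of denominator [n], the labels
    along [..., p + r, p, q, q + r, ...] satisfy a linear recurrence with
    characteristic roots [exp (+- n Phi r)].  For [l = p + i r] and
    [l' = q + i r], whose denominators [d], [d'] add up to [(2 i + 1) n], the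
    combination [d F l + d' F l' - (2 i + 1) n F r] vanishes on affine functions,
    and Fricke's identity shows that for [F = Phi] it is at least
    [c |D - 4| exp (- 2 n M)] in absolute value, [M] a bound of [Phi], whatever
    [i] is: [Phi] has a corner at [r].  When [r] is the [j]th convergent of
    [beta] and [i = 2 ^ (j n)], the points [l], [r], [l'] and [beta] lie within
    [O (2 ^ (- j n))] of each other, so at one of the three points the deviation
    of [Phi] from any affine function through [(beta, Phi beta)] is much larger
    than the square of its distance to [beta].  In particular no property of the
    slope [Phi' beta] is needed. *)

Require Import Defs.
From HB Require Import structures.
From mathcomp Require Import all_boot all_order all_algebra.
From mathcomp Require Import all_classical all_reals all_analysis.
From mathcomp Require Import zify ring lra.

Set Implicit Arguments.
Unset Strict Implicit.
Unset Printing Implicit Defensive.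

Import Order.TTheory GRing.Theory Num.Theory.
Import numFieldNormedType.Exports.

Local Open Scope ring_scope.
Local Open Scope classical_set_scope.

(** * Unimodular pairs of fractions, mediants and Farey pairs *)

(** The absolute value makes the relation symmetric, which suits consecutive convergents, as they
    alternate in order. *)
Definition unimodular (p q : rat) : Prop :=
  `|denq p * numq q - numq p * denq q| = 1.

Lemma unimodularC (p q : rat) : unimodular p q -> unimodular q p.
Proof. by rewrite /unimodular => <-; rewrite distrC; congr `|_ - _|; ring. Qed.

Lemma mediantC (p q : rat) : mediant p q = mediant q p.
Proof. by rewrite /mediant addrC (addrC (denq p)). Qed.

Lemma fraction_num_den (n d : int) : 0 < d -> coprimez n d ->
  numq (n%:Q / d%:Q) = n /\ denq (n%:Q / d%:Q) = d.
Proof.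
move=> d_gt0 cop; rewrite coprimeq_num // coprimeq_den //.
by rewrite gtr0_sg // mul1r gt_eqF // gtr0_norm.
Qed.

Lemma coprimez_of_bezout (a b n d : int) : `|a * n - b * d| = 1 -> coprimez n d.
Proof.
move=> H; apply/coprimezP; have [H1|H1] : a * n - b * d = 1 \/ a * n - b * d = -1.
  by lia.
- by exists (a, - b) => /=; rewrite mulNr.
- by exists (- a, b) => /=; rewrite mulNr; lia.
Qed.

(** Replacing [q] by the mediant leaves the determinant with [p] unchanged, so the summed numerators
    and denominators are again coprime. *)
Lemma unimodular_mediant (p q : rat) : unimodular p q ->
  [/\ numq (mediant p q) = numq p + numq q,
      denq (mediant p q) = denq p + denq q &
      unimodular p (mediant p q)].
Proof.
move=> pq; have H : `|denq p * (numq p + numq q) - numq p * (denq p + denq q)| = 1.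
  by rewrite -[RHS]pq; congr `|_|; ring.
have [] := @fraction_num_den (numq p + numq q) (denq p + denq q).
- by rewrite addr_gt0.
- exact: coprimez_of_bezout H.
by rewrite -/(mediant p q) /unimodular => -> ->.
Qed.

Lemma unimodular_mediant_r (p q : rat) : unimodular p q -> unimodular q (mediant p q).
Proof. by move=> /unimodularC/unimodular_mediant[_ _]; rewrite mediantC. Qed.

Lemma iter_mediant (p q : rat) (i : nat) : unimodular p q ->
  [/\ numq (iter i (mediant q) p) = numq p + i%:Z * numq q,
      denq (iter i (mediant q) p) = denq p + i%:Z * denq q &
      unimodular (iter i (mediant q) p) q].
Proof.
move=> pq; elim: i => [|i [IHn IHd IHu]] /=; first by rewrite !mul0r !addr0.
have [-> -> u] := unimodular_mediant (unimodularC IHu).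
by rewrite IHn IHd intS; split; [ring|ring|exact: unimodularC].
Qed.

(** The Stern-Brocot generation of neighbours, which lets relations between labels be propagated
    from the root by induction. *)
Inductive farey_pair : rat -> rat -> Prop :=
| FareyRoot : farey_pair 0 1
| FareyLeft p q : farey_pair p q -> farey_pair p (mediant p q)
| FareyRight p q : farey_pair p q -> farey_pair (mediant p q) q.

Lemma ltr_det (p q : rat) : (p < q) = (0 < denq p * numq q - numq p * denq q).
Proof.
rewrite -{1}(divq_num_den p) -{1}(divq_num_den q).
rewrite ltr_pdivrMr ?ltr0z // mulrAC ltr_pdivlMr ?ltr0z //.
by rewrite -!intrM ltr_int subr_gt0 (mulrC (numq q)).
Qed.

Lemma mediant_between (p q : rat) : unimodular p q -> p < q ->
  p < mediant p q < q.
Proof. by case/unimodular_mediant=> n d _; rewrite !ltr_det n d; lia. Qed.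

Lemma farey_neighbours_unimodular (p q : rat) :
  farey_neighbours p q -> unimodular p q.
Proof. by case/and4P => _ _ _ /eqP; rewrite /unimodular => ->. Qed.

Lemma farey_pair_neighbours (p q : rat) : farey_pair p q -> farey_neighbours p q.
Proof.
elim=> [//|{}p {}q _ H|{}p {}q _ H].
- have u := farey_neighbours_unimodular H; have [n d _] := unimodular_mediant u.
  case/and4P: H => p0 pq q1 /eqP E; have /andP[m1 m2] := mediant_between u pq.
  rewrite /farey_neighbours p0 m1 (le_trans (ltW m2)) //= n d -[X in _ == X]E.
  by apply/eqP; ring.
- have u := farey_neighbours_unimodular H; have [n d _] := unimodular_mediant u.
  case/and4P: H => p0 pq q1 /eqP E; have /andP[m1 m2] := mediant_between u pq.
  rewrite /farey_neighbours q1 m2 (le_trans p0 (ltW m1)) //= n d -[X in _ == X]E.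
  by apply/eqP; ring.
Qed.

Lemma farey_pair_unimodular (p q : rat) : farey_pair p q -> unimodular p q.
Proof. by move/farey_pair_neighbours/farey_neighbours_unimodular. Qed.

Lemma farey_pair_iter_l (p q : rat) (i : nat) :
  farey_pair p q -> farey_pair (iter i (mediant q) p) q.
Proof. by move=> pq; elim: i => //= i /FareyRight; rewrite mediantC. Qed.

Lemma farey_pair_iter_r (p q : rat) (i : nat) :
  farey_pair p q -> farey_pair p (iter i (mediant p) q).
Proof. by move=> pq; elim: i => //= i /FareyLeft. Qed.

Lemma farey_pair_vertex (p q : rat) :
  farey_pair p q -> farey_vertex p (mediant p q) q.
Proof. by move=> /farey_pair_neighbours. Qed.

(** * Labels of the regions of a Markov tree *)

Section Labels.
Variables (R : realType) (T : markov_tree R).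
Local Notation m := (label T).

(** Vieta involution: a step to an adjacent vertex replaces a label [x] by [y z - x], the other root
    of the same quadratic equation. *)
Lemma vertex_discriminator (p q : rat) : farey_pair p q ->
  m p ^+ 2 + m (mediant p q) ^+ 2 + m q ^+ 2 - m p * m (mediant p q) * m q
  = discriminator T.
Proof.
elim=> [|{}p {}q /farey_pair_vertex H <-|{}p {}q /farey_pair_vertex H <-].
- have -> : mediant 0 1 = 2^-1 by [].
  by rewrite label_0 label_1 label_half.
- by rewrite (label_left T H); ring.
- by rewrite (label_right T H); ring.
Qed.

(* The pair [(U_i, U_(i-1))] of Chebyshev polynomials of the second kind,
   evaluated at [z / 2]. *)
Fixpoint chebyshev (z : R) (i : nat) : R * R :=
  if i is i'.+1 then let c := chebyshev z i' in (z * c.1 - c.2, c.1) else (1, 0).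

(** The condition on [f 1] says that the sequence, extended backwards, takes the value [b] at index
    -1. *)
Lemma chebyshev_recurrence (z a b : R) (f : nat -> R) :
  f 0%N = a -> f 1%N = a * z - b -> (forall i, f i.+2 = f i.+1 * z - f i) ->
  forall i, f i = (chebyshev z i).1 * a - (chebyshev z i).2 * b.
Proof.
move=> f0 f1 fS i; suff [] : f i = (chebyshev z i).1 * a - (chebyshev z i).2 * b /\
  f i.+1 = (chebyshev z i.+1).1 * a - (chebyshev z i.+1).2 * b by [].
elim: i => [|i [IH0 IH1]]; first by rewrite f0 f1 /=; split; ring.
by split=> //; rewrite fS IH0 IH1 /=; ring.
Qed.

(** All these regions border the region [r], so their labels obey a recurrence with coefficient
    [m r]; one step backwards from [p] lies [q]. *)
Lemma label_iter_l (p q : rat) (i : nat) : farey_pair p q ->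
  let r := mediant p q in
  m (iter i (mediant r) p)
  = (chebyshev (m r) i).1 * m p - (chebyshev (m r) i).2 * m q.
Proof.
move=> pq r.
apply: (@chebyshev_recurrence _ _ _ (fun i => m (iter i (mediant r) p))) => //=.
  by rewrite mediantC; apply: label_left; exact: farey_pair_vertex.
move=> k; set s := iter k _ p.
have := farey_pair_vertex (farey_pair_iter_l k (FareyLeft pq)).
move=> /(label_right T); rewrite -/r -/s. by rewrite mediantC (mediantC s).
Qed.

Lemma label_iter_r (p q : rat) (i : nat) : farey_pair p q ->
  let r := mediant p q in
  m (iter i (mediant r) q)
  = (chebyshev (m r) i).1 * m q - (chebyshev (m r) i).2 * m p.
Proof.
move=> pq r.
apply: (@chebyshev_recurrence _ _ _ (fun i => m (iter i (mediant r) q))) => //=.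
  by rewrite mulrC; apply: label_right; exact: farey_pair_vertex.
move=> k; set s := iter k _ q.
have := farey_pair_vertex (farey_pair_iter_r k (FareyRight pq)).
by move=> /(label_left T); rewrite -/r -/s (mulrC (m r)).
Qed.

End Labels.

(** * Gaps between hyperbolic cosines and between their arguments *)

Section CoshGap.
Variable R : realType.
Implicit Types a b g z : R.

Definition dcosh (x : R) : R := expR x + expR (- x).

Lemma dcosh_ge2 a : 2 <= dcosh a.
Proof.
rewrite /dcosh expRN; set x := expR a; have x0 : 0 < x := expR_gt0 a.
rewrite -subr_ge0; have -> : x + x^-1 - 2 = (x - 1) ^+ 2 / x by field; rewrite gt_eqF.
by rewrite divr_ge0 ?sqr_ge0 ?ltW.
Qed.

Lemma dcosh_le_expR_norm a b : dcosh (a + b) <= expR `|b| * dcosh a.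
Proof.
rewrite /dcosh opprD mulrDr -!expRD.
by apply: lerD; rewrite ler_expR addrC lerD2r ?ler_norm // -normrN ler_norm.
Qed.

(** Together with [dcosh_mul] this gives the product and the sum of [dcosh (a + b)] and
    [dcosh (a - b)] as polynomials in [dcosh a] and [dcosh b], that is, in labels. *)
Lemma dcosh_add_sub a b :
  dcosh (a + b) * dcosh (a - b) = dcosh a ^+ 2 + dcosh b ^+ 2 - 4.
Proof.
rewrite /dcosh !opprD opprK !expRD !expRN.
by field; rewrite !gt_eqF ?expR_gt0.
Qed.

Lemma dcosh_mul a b : dcosh a * dcosh b = dcosh (a + b) + dcosh (a - b).
Proof.
rewrite /dcosh !opprD opprK !expRD !expRN.
by field; rewrite !gt_eqF ?expR_gt0.
Qed.

Lemma dcosh_sub_le_add a b : 0 <= a -> 0 <= b -> dcosh (a - b) <= dcosh (a + b).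
Proof.
move=> a0 b0; rewrite -subr_ge0.
have -> : dcosh (a + b) - dcosh (a - b)
    = (expR a - expR (- a)) * (expR b - expR (- b)).
  by rewrite /dcosh !opprD opprK !expRD !expRN; field; rewrite !gt_eqF ?expR_gt0.
by rewrite mulr_ge0 // subr_ge0 ler_expR; lra.
Qed.

(** Equivalent to [U_i = sinh ((i + 1) g) / sinh g], but free of division, so that [g = 0] is
    covered. *)
Lemma chebyshev_expR g i : let c := chebyshev (dcosh g) i in
  c.1 - c.2 * expR (- g) = expR (i%:R * g) /\
  c.1 - c.2 * expR g = expR (- (i%:R * g)).
Proof.
rewrite expRN (expRN (_ * _)) expRM_natl.
elim: i => [|i [IH1 IH2]] /=; first by rewrite !mul0r expr0 invr1 !subr0.
have g0 : expR g != 0 by rewrite gt_eqF ?expR_gt0.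
split; [rewrite exprS -IH1|rewrite exprS invfM -IH2]; rewrite /dcosh expRN;
  by field.
Qed.

Lemma chebyshev_ge1 z i : 2 <= z -> let c := chebyshev z i in
  1 <= c.1 ^+ 2 - c.2 ^+ 2.
Proof.
(* The invariant [U_i - U_(i-1) >= 1], [U_(i-1) >= 0] passes to the next index, unlike the claim
   alone. *)
move=> z2; suff : 1 <= (chebyshev z i).1 - (chebyshev z i).2 /\
  0 <= (chebyshev z i).2 by case: (chebyshev z i) => u v /=; nra.
elim: i => [|i] /=; first by lra.
by case: (chebyshev z i) => u v /=; nra.
Qed.

(* [W] is [U_(2i)]. *)
Lemma chebyshev_odd g i : let c := chebyshev (dcosh g) i in
  let W := c.1 ^+ 2 - c.2 ^+ 2 in
  [/\ c.1 ^+ 2 + c.2 ^+ 2 - dcosh g * c.1 * c.2 = 1,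
      dcosh ((2 * i%:R + 1) * g)
        = dcosh g * (c.1 ^+ 2 + c.2 ^+ 2) - 4 * c.1 * c.2 &
      dcosh ((2 * i%:R + 1) * g) ^+ 2 - 4 = (dcosh g ^+ 2 - 4) * W ^+ 2].
Proof.
have [] := chebyshev_expR g i; case: (chebyshev _ i) => u v /= E1 E2.
have g0 : expR g != 0 by rewrite gt_eqF ?expR_gt0.
(* The left side factors as [(u - v e^(-g)) (u - v e^g)], which is [e^(i g) e^(-i g)]. *)
have H1 : u ^+ 2 + v ^+ 2 - dcosh g * u * v = 1.
  rewrite -(expRxMexpNx_1 (i%:R * g)) -E1 -E2 /dcosh expRN; by field.
have H2 : dcosh ((2 * i%:R + 1) * g)
    = dcosh g * (u ^+ 2 + v ^+ 2) - 4 * u * v.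
  rewrite [in LHS]/dcosh.
  have -> : (2 * i%:R + 1) * g = g + (i%:R * g + i%:R * g) by ring.
  by rewrite !opprD !expRD -E1 -E2 /dcosh !expRN; field.
split=> //; rewrite H2.
have : dcosh g * u * v = u ^+ 2 + v ^+ 2 - 1 by rewrite -H1; ring.
move: (dcosh g) => z E.
have -> : (z * (u ^+ 2 + v ^+ 2) - 4 * u * v) ^+ 2 - 4
  = z ^+ 2 * (u ^+ 2 + v ^+ 2) ^+ 2 - 8 * (z * u * v) * (u ^+ 2 + v ^+ 2)
    + 16 * u ^+ 2 * v ^+ 2 - 4 by ring.
have -> : z ^+ 2 * (u ^+ 2 + v ^+ 2) ^+ 2
  = z ^+ 2 * (u ^+ 2 - v ^+ 2) ^+ 2 + 4 * (z * u * v) ^+ 2 by ring.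
by rewrite E; ring.
Qed.

(** The linear map from [(a0, a1)] to [(x, y)] has determinant [u^2 - v^2]; it matches the quadratic
    forms with middle coefficients [z] and [Z] up to the square of this determinant. *)
Lemma fricke_shift z u v a0 a1 (x := u * a0 - v * a1) (y := u * a1 - v * a0)
    (Z := z * (u ^+ 2 + v ^+ 2) - 4 * u * v) :
  u ^+ 2 + v ^+ 2 - z * u * v = 1 ->
  x ^+ 2 + y ^+ 2 - x * y * Z
  = (a0 ^+ 2 + a1 ^+ 2 - a0 * a1 * z) * (u ^+ 2 - v ^+ 2) ^+ 2.
Proof.
move=> E; rewrite /x /y /Z.
(* The cofactor with which the hypothesis enters the difference of the two sides. *)
set c := 4 * u * v * a0 * a1 - (u ^+ 2 + v ^+ 2) * (a0 ^+ 2 + a1 ^+ 2).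
transitivity ((a0 ^+ 2 + a1 ^+ 2 - a0 * a1 * z) * (u ^+ 2 - v ^+ 2) ^+ 2
  + (u ^+ 2 + v ^+ 2 - z * u * v - 1) * c); first by rewrite /c; ring.
by rewrite E subrr mul0r addr0.
Qed.

(** The product of the two gaps is at least of order [Z^2]. If [Q <= Z], the second factor is at
    most [Z], which leaves order [Z] for the first. Otherwise [Z < Q <= P], the first factor is the
    larger one, and a square root gives the same order. *)
Lemma product_gap (P Q Z z W K k : R) :
  2 <= Q <= P -> 2 <= Z -> 1 <= W -> Z ^+ 2 - 4 = (z ^+ 2 - 4) * W ^+ 2 ->
  `|(P - Z) * (Z - Q)| = K * W ^+ 2 -> 0 < k <= 1 -> k <= K ->
  k / (z ^+ 2 + 4) * Z <= `|P - Z|.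
Proof.
move=> /andP[Q2 QP] Z2 W1 EZ; rewrite normrM => EK /andP[k0 k1] kK.
set D := `|P - Z| in EK *; have D0 : 0 <= D by exact: normr_ge0.
have z0 : 0 < z ^+ 2 + 4 by rewrite ltr_wpDl ?sqr_ge0.
have W1' : 1 <= W ^+ 2 by rewrite expr_ge1 // (le_trans ler01).
(* As [W >= 1], the relation between [Z] and [W] yields [Z^2 <= (z^2 + 4) W^2]. *)
have HZ : k * Z ^+ 2 <= (z ^+ 2 + 4) * (D * `|Z - Q|).
  rewrite EK [leRHS]mulrCA; apply: (@ler_pM _ k K) => //; rewrite ?(ltW k0) ?sqr_ge0 //.
  by have := sqr_ge0 z; nra.
rewrite mulrAC ler_pdivrMr // [D * _]mulrC.
have [QZ|ZQ] := leP Q Z.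
  have ZQ : `|Z - Q| <= Z by rewrite ger0_norm ?subr_ge0 //; lra.
  rewrite -(ler_pM2r (_ : 0 < Z)); last by lra.
  rewrite -mulrA -expr2 (le_trans HZ) // -mulrA ler_pM2l //.
  by rewrite ler_wpM2l.
have ZQD : `|Z - Q| <= D.
  by rewrite /D ltr0_norm ?subr_lt0 // ger0_norm; lra.
rewrite -ler_sqr ?nnegrE ?mulr_ge0 ?(ltW k0) ?(ltW z0) //; last by lra.
apply: le_trans (_ : (z ^+ 2 + 4) * (k * Z ^+ 2) <= _).
  rewrite exprMn [k ^+ 2]expr2 -[leLHS]mulrA ler_wpM2r //.
    by rewrite mulr_ge0 ?sqr_ge0 ?(ltW k0).
  by have := sqr_ge0 z; lra.
have -> : ((z ^+ 2 + 4) * D) ^+ 2 = (z ^+ 2 + 4) * ((z ^+ 2 + 4) * (D * D)) by ring.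
by rewrite ler_pM2l // (le_trans HZ) // ler_pM2l // ler_wpM2l.
Qed.

Lemma expR_le_inv1B (x : R) : x < 1 -> expR x <= (1 - x)^-1.
Proof.
move=> x1; rewrite -[x in expR x]opprK expRN lef_pV2 ?posrE ?expR_gt0 ?subr_gt0 //.
by have := expR_ge1Dx (- x).
Qed.

(** Moving the argument by [h] changes [dcosh] by a factor of at most [e^|h|], so a relative gap
    between values forces an absolute gap between arguments, however large [g] is. *)
Lemma dcosh_gap a g (rho : R) : 0 <= rho <= 1 ->
  rho * dcosh g <= `|dcosh a - dcosh g| -> rho / 2 <= `|a - g|.
Proof.
move=> /andP[r0 r1] H; rewrite leNgt; apply/negP => lt.
have e1 : expR `|a - g| < 1 + rho.
  (* For [rho <= 1] one has [e^(rho/2) <= 1 / (1 - rho/2) <= 1 + rho]. *)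
  apply: lt_le_trans (_ : expR (rho / 2) <= _); first by rewrite ltr_expR.
  apply: le_trans (expR_le_inv1B _) _; first by lra.
  rewrite -[X in X <= _]mul1r ler_pdivrMr; last by lra.
  nra.
have H1 := dcosh_le_expR_norm g (a - g); have H2 := dcosh_le_expR_norm a (g - a).
rewrite distrC in H2; rewrite !subrKC in H1 H2.
have := dcosh_ge2 a; have := dcosh_ge2 g.
move: H H1 H2 e1; move: (dcosh a) (dcosh g) (expR _) => A G e.
have [AG|GA] := leP G A.
  by rewrite ger0_norm ?subr_ge0 //; nra.
by rewrite ltr0_norm ?subr_lt0 //; nra.
Qed.

(** Fricke's identity evaluates the product of the gaps of [dcosh (a + b)] and [dcosh (a - b)] from
    [dcosh ((2 i + 1) g)]; [product_gap] and [dcosh_gap] then turn it into a bound free of [i]. *)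
Lemma cosh_second_difference (a b g a0 a1 k : R) (i : nat) :
  let c := chebyshev (dcosh g) i in
  0 <= a -> 0 <= b ->
  dcosh a = c.1 * a0 - c.2 * a1 -> dcosh b = c.1 * a1 - c.2 * a0 ->
  0 < k <= 1 ->
  k <= `|a0 ^+ 2 + dcosh g ^+ 2 + a1 ^+ 2 - a0 * dcosh g * a1 - 4| ->
  k / (dcosh g ^+ 2 + 4) / 2 <= `|a + b - (2 * i%:R + 1) * g|.
Proof.
move=> c ha hb Ea Eb hk hK.
have [E1 E2 E3] := chebyshev_odd g i.
have W1 := chebyshev_ge1 i (dcosh_ge2 g).
apply: dcosh_gap.
  case/andP: hk => k0 k1; have z0 := sqr_ge0 (dcosh g).
  rewrite divr_ge0 ?(ltW k0) ?addr_ge0 //= ler_pdivrMr ?mul1r; lra.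
apply: (product_gap (Q := dcosh (a - b)) _ _ W1 E3 _ hk hK).
- by rewrite dcosh_ge2 dcosh_sub_le_add.
- exact: dcosh_ge2.
rewrite -[X in _ = _ * X]ger0_norm ?sqr_ge0 // -normrM -normrN; congr `|_|.
(* Fricke's identity: [(P - Z) (Z - Q) = - (D - 4) W^2]. *)
set P := dcosh (a + b); set Q := dcosh (a - b); set Z := dcosh _.
have -> : - ((P - Z) * (Z - Q)) = P * Q - (P + Q) * Z + Z ^+ 2 by ring.
rewrite /P /Q -dcosh_mul dcosh_add_sub Ea Eb -/c.
have := fricke_shift a0 a1 E1; rewrite -E2 -/Z -/c => E.
have -> : (c.1 * a0 - c.2 * a1) ^+ 2 + (c.1 * a1 - c.2 * a0) ^+ 2 - 4
  - (c.1 * a0 - c.2 * a1) * (c.1 * a1 - c.2 * a0) * Z + Z ^+ 2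
  = ((c.1 * a0 - c.2 * a1) ^+ 2 + (c.1 * a1 - c.2 * a0) ^+ 2
  - (c.1 * a0 - c.2 * a1) * (c.1 * a1 - c.2 * a0) * Z) + (Z ^+ 2 - 4) by ring.
by rewrite E E3 -/c; ring.
Qed.

End CoshGap.

(** * Continuants and finite continued fractions *)

(* The numerators and denominators of the last two convergents. *)
Definition continuants (s : seq nat) : (nat * nat) * (nat * nat) :=
  foldl (fun c b => ((b * c.1.1 + c.2.1, b * c.1.2 + c.2.2), c.1)%N)
    ((1, 0), (0, 1))%N s.

Lemma continuants_rcons (s : seq nat) (b : nat) (c := continuants s) :
  continuants (rcons s b)
  = ((b * c.1.1 + c.2.1, b * c.1.2 + c.2.2), c.1)%N.
Proof. by rewrite /continuants -cats1 foldl_cat. Qed.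

(** In this form the last partial quotient can be replaced by a variable, as the induction of
    [foldr_continuants] demands. *)
Lemma cfrac_foldr (s : seq nat) (b : nat) :
  cfrac (rcons s b) = foldr (fun a y => a%:R + y^-1) b%:R s.
Proof. by elim: s => [|a s /= ->] //=; rewrite invr0 addr0. Qed.

(** The tail [x] enters through a Möbius map whose matrix columns are the last two convergents. A
    final term [b] is absorbed by passing from [x] to [b + 1/x], hence the induction from the right
    with [x] general. *)
Lemma foldr_continuants (F : numFieldType) (s : seq nat) (x : F) (c := continuants s) : 0 < x ->
  0 < c.1.2%:R * x + c.2.2%:R /\
  foldr (fun a y => a%:R + y^-1) x s
  = (c.1.1%:R * x + c.2.1%:R) / (c.1.2%:R * x + c.2.2%:R).
Proof.
rewrite {}/c; elim/last_ind: s x => [|s b IH] x x0.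
  by rewrite /= mul0r add0r mul1r addr0 divr1.
rewrite continuants_rcons foldr_rcons /=.
have y0 : 0 < b%:R + x^-1 by rewrite ltr_wpDl ?ler0n ?invr_gt0.
have [d0 ->] := IH _ y0.
move: (continuants s) d0 => -[[p q] [p' q']] /= d0.
rewrite !natrD !natrM.
have d1 : 0 < (b%:R * q%:R + q'%:R) * x + q%:R.
  suff -> : (b%:R * q%:R + q'%:R) * x + q%:R = x * (q%:R * (b%:R + x^-1) + q'%:R).
    by rewrite mulr_gt0.
  by field; rewrite gt_eqF.
by split=> //; field; rewrite !gt_eqF.
Qed.

Lemma cfrac_continuants (s : seq nat) (b : nat) (c := continuants (rcons s b)) :
  (0 < b)%N -> cfrac (rcons s b) = c.1.1%:R / c.1.2%:R.
Proof.
move=> b0; rewrite /c cfrac_foldr continuants_rcons /=.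
have [] := @foldr_continuants _ s (b%:R : rat); first by rewrite ltr0n.
by move=> _ ->; rewrite !natrD !natrM ![_ * b%:R]mulrC.
Qed.

(** * The convergents of [beta] in the Farey tree *)

Definition farey_adjacent (p q : rat) : Prop := farey_pair p q \/ farey_pair q p.

Lemma farey_adjacent_iter (p q : rat) (i : nat) :
  farey_adjacent p q -> farey_adjacent (iter i (mediant q) p) q.
Proof.
by case=> [/farey_pair_iter_l|/farey_pair_iter_r] H; [left|right]; exact: H.
Qed.

Lemma farey_adjacent_unimodular (p q : rat) : farey_adjacent p q -> unimodular p q.
Proof.
by case=> [/farey_pair_unimodular|/farey_pair_unimodular/unimodularC].
Qed.

Definition beta_convergent (j : nat) : rat := cfrac (beta_terms j).
Definition beta_exponent (j : nat) : nat := (j * `|denq (beta_convergent j)|)%N.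

Lemma beta_terms_S (j : nat) :
  beta_terms j.+2 = rcons (beta_terms j.+1) (2 ^ beta_exponent j.+1)%N.
Proof. by []. Qed.

(** The induction invariant. Its last component says that the continuants are already in lowest
    terms, so that [denq] in [beta_terms] follows the usual recurrence; nonnegativity removes the
    absolute values. *)
Definition beta_adjacent (j : nat)
    (v := fun q : rat => (`|numq q|, `|denq q|)%N) : Prop :=
  [/\ farey_adjacent (beta_convergent j) (beta_convergent j.+1),
      0 <= beta_convergent j, 0 <= beta_convergent j.+1 &
      continuants (beta_terms j.+1)
      = (v (beta_convergent j.+1), v (beta_convergent j))].

(** Adding a convergent [b] times to its predecessor by mediants is the continuant recurrence with
    partial quotient [b]. *)
Lemma beta_adjacent_S (j : nat)
    (q := iter (2 ^ beta_exponent j.+1) (mediant (beta_convergent j.+1))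
            (beta_convergent j)) :
  beta_adjacent j -> beta_convergent j.+2 = q /\ beta_adjacent j.+1.
Proof.
case=> adj q0 q1 E; rewrite {}/q; set b := (2 ^ _)%N; set q := iter b _ _.
have b0 : (0 < b)%N by rewrite expn_gt0.
have [n d _] := iter_mediant b (farey_adjacent_unimodular adj).
have adjq : farey_adjacent q (beta_convergent j.+1) by exact: farey_adjacent_iter.
have nE : numq q = (b * `|numq (beta_convergent j.+1)| + `|numq (beta_convergent j)|)%N.
  by rewrite n PoszD PoszM !gez0_abs ?numq_ge0 // addrC.
have dE : denq q = (b * `|denq (beta_convergent j.+1)| + `|denq (beta_convergent j)|)%N.
  by rewrite d PoszD PoszM !gez0_abs // addrC.
have Eq : beta_convergent j.+2 = q.
  rewrite /beta_convergent beta_terms_S cfrac_continuants // continuants_rcons E /=.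
  by rewrite -[RHS]divq_num_den nE dE -!pmulrn.
split=> //; split; rewrite ?Eq //.
- by case: adjq; [right|left].
- by rewrite -numq_ge0 nE.
- by rewrite beta_terms_S continuants_rcons E nE dE /=.
Qed.

Lemma beta_adjacentP (j : nat) : beta_adjacent j.
Proof.
elim: j => [|j /beta_adjacent_S[] //].
(* The convergents [[0]] and [[0, 1]] are [0] and [1], the root pair. *)
by split => //; left; exact: FareyRoot.
Qed.

Lemma beta_convergent_S (j : nat) :
  beta_convergent j.+2
  = iter (2 ^ beta_exponent j.+1) (mediant (beta_convergent j.+1)) (beta_convergent j).
Proof. by have [] := beta_adjacent_S (beta_adjacentP j). Qed.

(** The partial quotient is positive, so the last of the iterated mediants can be split off. The
    index starts at 2 because the first two convergents are the end points [0] and [1]. *)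
Lemma beta_convergent_vertex (j : nat) : exists p q : rat,
  farey_pair p q /\ mediant p q = beta_convergent j.+2.
Proof.
have [adj _ _ _] := beta_adjacentP j; rewrite beta_convergent_S.
have -> : (2 ^ beta_exponent j.+1)%N = (2 ^ beta_exponent j.+1).-1.+1.
  by rewrite prednK // expn_gt0.
rewrite iterS; case: (farey_adjacent_iter (2 ^ beta_exponent j.+1).-1 adj) => H.
- by exists (iter (2 ^ beta_exponent j.+1).-1 (mediant (beta_convergent j.+1))
              (beta_convergent j)), (beta_convergent j.+1); rewrite mediantC.
- by exists (beta_convergent j.+1), (iter (2 ^ beta_exponent j.+1).-1
    (mediant (beta_convergent j.+1)) (beta_convergent j)).
Qed.

Lemma beta_denq_S (j : nat) : `|denq (beta_convergent j.+2)|%N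
  = (2 ^ beta_exponent j.+1 * `|denq (beta_convergent j.+1)|
     + `|denq (beta_convergent j)|)%N.
Proof.
have [adj _ _ _] := beta_adjacentP j; rewrite beta_convergent_S.
have [_ -> _] := iter_mediant (2 ^ beta_exponent j.+1) (farey_adjacent_unimodular adj).
apply/eqP; rewrite -eqz_nat gez0_abs; last by rewrite addr_ge0 ?mulr_ge0.
by rewrite PoszD PoszM !gez0_abs // addrC.
Qed.

Lemma absz_denq_gt0 (q : rat) : (0 < `|denq q|)%N.
Proof. by rewrite absz_gt0. Qed.

Lemma beta_exponent_lt (j : nat) : (beta_exponent j.+1 < beta_exponent j.+2)%N.
Proof.
rewrite /beta_exponent beta_denq_S.
have := absz_denq_gt0 (beta_convergent j).
have : (0 < 2 ^ beta_exponent j.+1)%N by rewrite expn_gt0.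
set b := (2 ^ _)%N; set v := `|_|%N; set w := `|_|%N => b0 w0.
have : (v <= b * v)%N by rewrite leq_pmull.
by move: (b * v)%N => u; nia.
Qed.

(** * Rate of convergence to [beta] *)

Section BetaLimit.
Variable R : realType.

Lemma denq_natr (q : rat) : (denq q)%:~R = `|denq q|%N%:R :> R.
Proof. by rewrite pmulrn gez0_abs. Qed.

Lemma ratr_dist (p q : rat) : unimodular p q ->
  `|ratr q - ratr p : R| = ((denq p)%:~R * (denq q)%:~R)^-1.
Proof.
move=> u; have dp : 0 < (denq p)%:~R :> R by rewrite ltr0z.
have dq : 0 < (denq q)%:~R :> R by rewrite ltr0z.
have -> : ratr q - ratr p = (denq p * numq q - numq p * denq q)%:~R
    / ((denq p)%:~R * (denq q)%:~R) :> R.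
  by rewrite /ratr intrB !intrM; field; rewrite !gt_eqF.
rewrite normrM normfV [X in _ / X]gtr0_norm ?mulr_gt0 //.
by rewrite -intr_norm u mul1r.
Qed.

(** The distance is the inverse product of the denominators, and the later one is at least the
    partial quotient [2 ^ beta_exponent j.+1]. *)
Lemma beta_convergent_dist (j : nat) :
  `|ratr (beta_convergent j.+2) - ratr (beta_convergent j.+1) : R|
  <= 2 ^- beta_exponent j.+1.
Proof.
have [adj _ _ _] := beta_adjacentP j.+1.
rewrite ratr_dist; last exact: farey_adjacent_unimodular.
rewrite lef_pV2 ?posrE ?exprn_gt0 ?mulr_gt0 ?ltr0z // !denq_natr.
rewrite -natrX -natrM ler_nat beta_denq_S.
apply: leq_trans (leq_pmull _ (absz_denq_gt0 _)).
by apply: leq_trans (leq_addr _ _); rewrite leq_pmulr ?absz_denq_gt0.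
Qed.

(** The exponents grow by at least one per step, so a geometric series dominates; the factor
    [1 - 2^(-k)] is its partial sum and lets the induction close. *)
Lemma beta_convergent_tail (j k : nat) :
  `|ratr (beta_convergent (j + k).+1) - ratr (beta_convergent j.+1) : R|
  <= 2 * 2 ^- beta_exponent j.+1 * (1 - 2 ^- k).
Proof.
elim: k => [|k IH]; first by rewrite addn0 subrr normr0 expr0 invr1 subrr mulr0.
rewrite addnS -(subrKA (ratr (beta_convergent (j + k).+1))).
apply: (le_trans (ler_normD _ _)).
have H := beta_convergent_dist (j + k).
apply: (le_trans (lerD H IH)).
have : (2 : R) ^- beta_exponent (j + k).+1 <= 2 ^- beta_exponent j.+1 * 2 ^- k.
  rewrite -invfM -exprD lef_pV2 ?posrE ?exprn_gt0 // ler_eXn2l ?ltr1n //.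
  elim: k {IH H} => [|k IH]; first by rewrite !addn0.
  by rewrite !addnS; apply: leq_ltn_trans IH (beta_exponent_lt _).
rewrite exprS invfM {H IH}.
by move: (2 ^- beta_exponent (j + k).+1) (2 ^- beta_exponent j.+1) (2 ^- k) => x y z; lra.
Qed.

Lemma beta_convergent_near (j k : nat) : (j <= k)%N ->
  `|ratr (beta_convergent k.+1) - ratr (beta_convergent j.+1) : R|
  <= 2 * 2 ^- beta_exponent j.+1.
Proof.
move=> /subnKC <-; apply: (le_trans (beta_convergent_tail _ _)).
by rewrite ler_piMr ?mulr_ge0 ?invr_ge0 ?exprn_ge0 // lerBlDr lerDl.
Qed.

Lemma leq_beta_exponent (j : nat) : (j <= beta_exponent j)%N.
Proof. by rewrite leq_pmulr ?absz_denq_gt0. Qed.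

Lemma beta_cvg : (fun j => ratr (beta_convergent j) : R) @ \oo --> beta R.
Proof.
(* [beta] is defined by [limn], which is a genuine limit only once convergence is known. *)
suff C : cvg ((fun j => ratr (beta_convergent j) : R) @ \oo) by exact: C.
apply: cauchy_cvg; apply: cauchy_exP => e e0.
have [k ek] : exists k : nat, 2 * (2 : R) ^- k.+1 < e.
  have e2 : 0 < e / 2 by rewrite divr_gt0.
  have [N _ /(_ N.+1 (leqnSn _))] := near_infty_natSinv_expn_lt (PosNum e2).
  rewrite /= div1r => H; exists N.
  by move: H; move: (2 ^- _) => x; lra.
exists (ratr (beta_convergent k.+2)); exists k.+2 => //= -[//|l] /= kl.
rewrite /ball /= distrC (le_lt_trans (@beta_convergent_near k.+1 l kl)) //.
apply: le_lt_trans ek; rewrite ler_pM2l // lef_pV2 ?posrE ?exprn_gt0 //.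
by rewrite ler_eXn2l ?ltr1n // (ltnW (leq_beta_exponent _)).
Qed.

Lemma beta_dist (j : nat) :
  `|beta R - ratr (beta_convergent j.+1)| <= 2 * 2 ^- beta_exponent j.+1.
Proof.
set q := ratr _; have C : `|ratr (beta_convergent k) - q| @[k --> \oo] --> `|beta R - q|.
  by apply: cvg_norm; apply: cvgB; [exact: beta_cvg|exact: cvg_cst].
apply: (cvgr_to_le C).
by exists j.+1 => //= -[//|k] jk; exact: beta_convergent_near.
Qed.

End BetaLimit.

(** * The corners of the encoding function *)

Section Encoding.
Variables (R : realType) (T : markov_tree R) (Phi : R -> R).
Hypothesis hPhi : encoding_function T Phi.

(** The degree-one homogeneous extension of [Phi], taken at the vector of denominator and numerator;
    labels are its [dcosh]. *)
Let weighted (q : rat) : R := (denq q)%:~R * Phi (ratr q).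

Lemma ratr_01 (q : rat) : 0 <= q <= 1 -> 0 <= (ratr q : R) <= 1.
Proof. by case/andP=> q0 q1; rewrite ler0q q0 -(rmorph1 (@ratr R)) ler_rat. Qed.

Lemma label_dcosh (q : rat) : 0 <= q <= 1 -> label T q = dcosh (weighted q).
Proof.
case: hPhi => _ _ H /H ->; rewrite /Defs.cosh /dcosh /weighted.
by rewrite mulrC divfK ?pnatr_eq0.
Qed.

Lemma weighted_ge0 (q : rat) : 0 <= q <= 1 -> 0 <= weighted q.
Proof.
case: hPhi => _ H _ /ratr_01/H H1.
by rewrite mulr_ge0 // ler0z.
Qed.

Lemma farey_pair_01 (p q : rat) :
  farey_pair p q -> 0 <= p <= 1 /\ 0 <= q <= 1.
Proof.
move=> /farey_pair_neighbours/and4P[p0 pq q1 _].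
by rewrite p0 q1 (le_trans (ltW pq)) // (le_trans p0 (ltW pq)).
Qed.

(** [cosh_second_difference] applies with the labels of [p] and [q] as [a0] and [a1]; its constant
    depends only on the label of [r], which [M] controls. *)
Lemma second_difference_lower_bound (M k : R) (p q : rat) (i : nat)
    (r := mediant p q) (l := iter i (mediant r) p) (l' := iter i (mediant r) q) :
  farey_pair p q -> (forall x, 0 <= x <= 1 -> Phi x <= M) ->
  0 < k <= 1 -> k <= `|discriminator T - 4| ->
  k / 16 * expR (- (2 * M)) ^+ `|denq r|
  <= `|weighted l + weighted l' - (2 * i%:R + 1) * weighted r|.
Proof.
move=> pq hM hk hD.
have [p01 q01] := farey_pair_01 pq.
have [_ r01] := farey_pair_01 (FareyLeft pq).
have [l01 _] := farey_pair_01 (farey_pair_iter_l i (FareyLeft pq)).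
have [_ l'01] := farey_pair_01 (farey_pair_iter_r i (FareyRight pq)).
have H : k / (dcosh (weighted r) ^+ 2 + 4) / 2
    <= `|weighted l + weighted l' - (2 * i%:R + 1) * weighted r|.
  apply: (@cosh_second_difference _ _ _ _ (label T p) (label T q)) => //.
  - exact: weighted_ge0.
  - exact: weighted_ge0.
  - by rewrite -!label_dcosh // label_iter_l.
  - by rewrite -!label_dcosh // label_iter_r.
  - by rewrite -label_dcosh // vertex_discriminator.
apply: le_trans H; case/andP: hk => k0 _.
set g := weighted r; have g0 : 0 <= g by exact: weighted_ge0.
have gM : expR (2 * g) <= expR (2 * M) ^+ `|denq r|.
  rewrite -expRM_natl ler_expR [leRHS]mulrCA ler_pM2l // /g /weighted denq_natr.
  by rewrite ler_wpM2l // hM // ratr_01.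
rewrite expRN exprVn; set E := expR (2 * M) ^+ _ in gM *.
have e1 : expR (- g) <= expR g by rewrite ler_expR; lra.
have e2 : 1 <= expR g by rewrite -expR0 ler_expR.
have E2 : expR (2 * g) = expR g ^+ 2 by rewrite expRM_natl.
rewrite E2 in gM.
(* [dcosh g <= 2 e^g] and [1 <= e^(2 g) <= E] bound the two summands by [4 E] each. *)
have D8 : dcosh g ^+ 2 + 4 <= 8 * E.
  by rewrite /dcosh; have := expR_gt0 (- g); move: gM e1 e2; nra.
have D0 : 0 < dcosh g ^+ 2 + 4 by rewrite ltr_wpDl ?sqr_ge0.
have -> : k / 16 / E = k / 2 * (8 * E)^-1.
  by rewrite invfM; field; rewrite gt_eqF // exprn_gt0 // expR_gt0.
rewrite [leRHS]mulrAC ler_pM2l ?divr_gt0 // lef_pV2 ?posrE //.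
by rewrite (lt_le_trans D0 D8).
Qed.

(** As integer vectors, [l + l' = p + q + 2 i r = (2 i + 1) r]; this is why the second difference
    kills affine functions. *)
Lemma iter_mediant_sum (p q : rat) (i : nat)
    (r := mediant p q) (l := iter i (mediant r) p) (l' := iter i (mediant r) q) :
  unimodular p q ->
  numq l + numq l' = (2 * i%:Z + 1) * numq r /\
  denq l + denq l' = (2 * i%:Z + 1) * denq r.
Proof.
move=> pq; have [n d pr] := unimodular_mediant pq.
have [nl dl _] := iter_mediant i pr.
have [nl' dl' _] := iter_mediant i (unimodular_mediant_r pq).
by rewrite /l /l' nl nl' dl dl' -/r n d; split; ring.
Qed.

Lemma iter_mediant_dist (p q : rat) (i : nat) : unimodular p q -> (0 < i)%N ->
  `|ratr (iter i (mediant q) p) - ratr q : R| <= i%:R^-1.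
Proof.
move=> pq i0; have [_ d u] := iter_mediant i pq.
rewrite (ratr_dist _ (unimodularC u)) lef_pV2 ?posrE ?ltr0n ?mulr_gt0 ?ltr0z //.
rewrite -intrM d pmulrn ler_int.
apply: (@le_trans _ _ (denq p + i%:Z * denq q)).
  by apply: ler_wpDl => //; rewrite ler_peMr // -gtz0_ge1.
by rewrite ler_peMl ?addr_ge0 ?mulr_ge0 // -gtz0_ge1.
Qed.

(** Subtracting an affine function leaves the second difference unchanged, so the remainders at [l],
    [l'] and [r] cannot all be small. *)
Lemma large_remainder (L b M k : R) (p q : rat) (i : nat) (r := mediant p q) :
  farey_pair p q -> (forall x, 0 <= x <= 1 -> Phi x <= M) ->
  0 < k <= 1 -> k <= `|discriminator T - 4| -> (0 < i)%N ->
  exists y : R, [/\ 0 <= y <= 1, `|y - ratr r| <= i%:R^-1 &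
    k / 16 * expR (- (2 * M)) ^+ `|denq r|
    <= 6 * i%:R * `|denq r|%N%:R * `|Phi y - Phi b - L * (y - b)|].
Proof.
move=> pq hM hk hD i0.
have := second_difference_lower_bound i pq hM hk hD; rewrite -/r.
have pu := farey_pair_unimodular pq.
have [En Ed] := iter_mediant_sum i pu; move: En Ed; rewrite -/r.
have [_ r01] := farey_pair_01 (FareyLeft pq).
have [l01 _] := farey_pair_01 (farey_pair_iter_l i (FareyLeft pq)).
have [_ l'01] := farey_pair_01 (farey_pair_iter_r i (FareyRight pq)).
have [_ _ pr] := unimodular_mediant pu.
have dl := iter_mediant_dist pr i0.
have dl' := iter_mediant_dist (unimodular_mediant_r pu) i0.
move: r01 l01 l'01 dl dl'; rewrite -/r.
set l := iter i _ p; set l' := iter i _ q => r01 l01 l'01 dl dl' En Ed.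
set S := k / 16 * _ => HS.
pose F y := Phi y - Phi b - L * (y - b).
have numE (t : rat) : (denq t)%:~R * ratr t = (numq t)%:~R :> R.
  by rewrite /ratr mulrCA divff ?mulr1 // intr_eq0.
move/(congr1 (fun z : int => z%:~R : R)): En; rewrite intrD intrM -!numE => En.
move/(congr1 (fun z : int => z%:~R : R)): Ed; rewrite intrD intrM => Ed.
have ci : (2 * i%:Z + 1)%:~R = 2 * i%:R + 1 :> R by rewrite intrD intrM.
rewrite ci in En Ed.
have SE : weighted l + weighted l' - (2 * i%:R + 1) * weighted r
  = (denq l)%:~R * F (ratr l) + (denq l')%:~R * F (ratr l')
    - (2 * i%:R + 1) * (denq r)%:~R * F (ratr r).
  rewrite /weighted /F; apply/eqP; rewrite -subr_eq0; apply/eqP.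
  transitivity ((Phi b - L * b)
      * ((denq l)%:~R + (denq l')%:~R - (2 * i%:R + 1) * (denq r)%:~R)
    + L * ((denq l)%:~R * ratr l + (denq l')%:~R * ratr l'
      - (2 * i%:R + 1) * ((denq r)%:~R * ratr r))); first by ring.
  by rewrite En Ed !subrr !mulr0 addr0.
have i1 : 1 <= i%:R :> R by rewrite ler1n.
have dr : 0 < (denq r)%:~R :> R by rewrite ltr0z.
have dl0 : 0 < (denq l)%:~R :> R by rewrite ltr0z.
have dl'0 : 0 < (denq l')%:~R :> R by rewrite ltr0z.
(* The weights of the three remainders add up to [2 (2 i + 1) n], with [n] the denominator of [r],
   and this is at most [6 i n] because [i >= 1]. *)
set e := S / (6 * i%:R * (denq r)%:~R).
have main (y : R) : e <= `|F y| -> S <= 6 * i%:R * `|denq r|%N%:R * `|F y|.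
  by rewrite -denq_natr /e ler_pdivrMr ?mulr_gt0 ?ltr0n // mulrC.
have [hl|hl] := leP e `|F (ratr l)|.
  by exists (ratr l); split; [exact: ratr_01| |exact: main].
have [hl'|hl'] := leP e `|F (ratr l')|.
  by exists (ratr l'); split; [exact: ratr_01| |exact: main].
exists (ratr r); split; [exact: ratr_01|by rewrite subrr normr0 invr_ge0|].
apply: main; rewrite leNgt; apply/negP => hr.
move: HS; rewrite SE; apply/negP; rewrite -ltNge.
apply: (le_lt_trans (ler_normB _ _)).
apply: (le_lt_trans (lerD (ler_normD _ _) (lexx _))).
rewrite !normrM !(gtr0_norm dl0) (gtr0_norm dl'0) (gtr0_norm dr).
rewrite (gtr0_norm (_ : 0 < 2 * i%:R + 1)); last by lra.
have H1 := ltr_pM2l dl0 `|F (ratr l)| e; rewrite hl in H1.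
have H2 := ltr_pM2l dl'0 `|F (ratr l')| e; rewrite hl' in H2.
have d3 : 0 < (2 * i%:R + 1) * (denq r)%:~R :> R by rewrite mulr_gt0 //; lra.
have H3 := ltr_pM2l d3 `|F (ratr r)| e; rewrite hr in H3.
have e0 : 0 < e by exact: le_lt_trans hr.
have Se : S = 6 * i%:R * (denq r)%:~R * e.
  by rewrite /e mulrC divfK // gt_eqF // !mulr_gt0 ?ltr0n.
rewrite Se; clear -H1 H2 H3 e0 i1 dr Ed.
have : (denq l)%:~R * e + (denq l')%:~R * e = (2 * i%:R + 1) * (denq r)%:~R * e.
  by rewrite -mulrDl Ed.
have : 0 <= (i%:R - 1) * (denq r)%:~R * e.
  by apply: mulr_ge0 (ltW e0); apply: mulr_ge0 (ltW dr); rewrite subr_ge0.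
move: H1 H2 H3.
lra.
Qed.

End Encoding.

(** * Growth comparison and conclusion *)

(** Once [2^j] exceeds [A = (1 + C) 2 K], the power [A^n] already dominates [C n K^n]. The threshold
    for [j] is uniform in [n], so [n] may later depend on [j]. *)
Lemma exponential_domination (R : realType) (C K : R) : 0 < C -> 1 <= K ->
  \forall j \near \oo, forall n : nat, (0 < n)%N ->
    C * n%:R * K ^+ n < 2 ^+ (j * n).
Proof.
move=> C0 K1; pose A := (1 + C) * (2 * K).
have A0 : 0 < A by rewrite !mulr_gt0 // ?addr_gt0 // (lt_le_trans ltr01).
have iA : 0 < A^-1 by rewrite invr_gt0.
apply: filterS (near_infty_natSinv_expn_lt (PosNum iA)) => j /= + n n0.
rewrite div1r ltf_pV2 ?posrE ?exprn_gt0 // => Aj.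
apply: le_lt_trans (_ : A ^+ n < _); last first.
  by rewrite exprM ltrXn2r ?lt0n_neq0 ?ltW.
rewrite /A !exprMn mulrA ler_wpM2r ?exprn_ge0 ?(le_trans ler01) //.
have C1 : C <= (1 + C) ^+ n.
  apply: (@le_trans _ _ (1 + C)); first by rewrite lerDr.
  by rewrite -[leLHS]expr1 ler_weXn2l // lerDl ltW.
apply: ler_pM => //; [exact: ltW|].
by rewrite -natrX ler_nat ltnW // ltn_expl.
Qed.

(** If one of [s_0], [t_0] is 2, then [D - 4] is the square of the difference of [u_0] and the
    other, which is positive. *)
Lemma discriminator_neq4 (R : realType) (T : markov_tree R) :
  progressing_tree T -> discriminator T <> 4.
Proof.
case=> /andP[_ su] /andP[_ tu] /eqP; rewrite mulf_eq0 !subr_eq0 /discriminator.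
by case/orP => /eqP E; rewrite E in su tu *; nra.
Qed.

Theorem theorem5p6 (R : realType) (T : markov_tree R) (Phi : R -> R)
    (hT : (rising_tree T /\ discriminator T <> 4) \/ progressing_tree T)
    (hPhi : encoding_function T Phi) :
  exists x : nat -> R,
    [/\ x j @[j --> \oo] --> (0 : R),
        (forall j : nat, 0 <= x j + beta R <= 1) &
        (forall B : R, 0 < B ->
           \forall j \near \oo,
             `|Phi (x j + beta R) - Phi (beta R) - derive1 Phi (beta R) * x j|
               > B * `|x j| ^+ 2)].
Proof.
have hD : discriminator T <> 4 by case: hT => [[]//|/discriminator_neq4].
have [cont Phi0 _] := hPhi.
have [c c01 hc] := EVT_max (@ler01 R) cont.
pose M := Phi c.
have hM (x : R) : 0 <= x <= 1 -> Phi x <= M by move=> x01; apply: hc; rewrite in_itv.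
have M0 : 0 <= M by apply: Phi0; rewrite in_itv in c01.
(* Capped at 1 as the gap estimates require; positive because [D] differs from 4. *)
pose k : R := Num.min 1 `|discriminator T - 4|.
have hk : 0 < k <= 1.
  by rewrite /k lt_min ge_min lexx ltr01 normr_gt0 subr_eq0 /= andbT; apply/eqP.
have kD : k <= `|discriminator T - 4| by rewrite /k ge_min lexx orbT.
set L := derive1 Phi (beta R).
pose n j := `|denq (beta_convergent j.+2)|%N.
pose N j := beta_exponent j.+2.
have thrice (z : R) : z + 2 * z = 3 * z by ring.
(* The corner at the convergent of index [j + 2] is probed with [i = 2 ^ N j]. The chosen point and
   [beta] lie within [2^(-N j)] and [2 * 2^(-N j)] of it, hence the factor 3. *)
have step j : exists x : R, [/\ 0 <= x + beta R <= 1, `|x| <= 3 * 2 ^- N j &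
    k / 16 * expR (- (2 * M)) ^+ n j <= 6 * 2 ^+ N j * (n j)%:R
      * `|Phi (x + beta R) - Phi (beta R) - L * x|].
  have [p [q [pq E]]] := beta_convergent_vertex j.
  have i0 : (0 < 2 ^ N j)%N by rewrite expn_gt0.
  have [y []] := large_remainder hPhi L (beta R) pq hM hk kD i0.
  rewrite E natrX => y01 yr H.
  exists (y - beta R); rewrite subrK; split => //.
  rewrite -(subrKA (ratr (beta_convergent j.+2))).
  apply: (le_trans (ler_normD _ _)).
  have := beta_dist R j.+1; rewrite distrC => H2.
  apply: (le_trans (lerD yr H2)); rewrite thrice; exact: lexx.
have [x hx] := choice step; exists x; split.
- apply/cvgrPdist_le => e e0; have e3 : 0 < e / 3 by rewrite divr_gt0.
  apply: filterS (near_infty_natSinv_expn_lt (PosNum e3)) => j /=.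
  rewrite div1r sub0r normrN => ej; have [_ H _] := hx j; apply: (le_trans H).
  rewrite mulrC -ler_pdivlMr //; apply: le_trans (ltW ej).
  rewrite lef_pV2 ?posrE ?exprn_gt0 // ler_eXn2l ?ltr1n //.
  by apply: leq_trans (leq_beta_exponent _); rewrite (leq_trans (leqnSn _)).
- by move=> j; have [] := hx j.
move=> B B0; case/andP: hk => k0 _.
(* The constant is [6 * 9 * 16]: 6 from the weights, 9 from squaring [3 * 2^(-N j)], 16 from the
   corner estimate. *)
have C0 : 0 < 864 * B / k by apply: divr_gt0 k0; apply: mulr_gt0 B0; rewrite ltr0n.
have K1 : 1 <= expR (2 * M) by rewrite -expR0 ler_expR mulr_ge0.
apply: filterS (exponential_domination C0 K1) => j /(_ (n j) (absz_denq_gt0 _)) H.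
have [_ xN Hlow] := hx j; rewrite ltNge; apply/negP => Hup.
move: Hlow; apply/negP; rewrite -ltNge.
have P0 : 0 < (2 : R) ^+ N j by rewrite exprn_gt0.
have n0 : 0 < (n j)%:R :> R by rewrite ltr0n absz_denq_gt0.
have E0 : 0 < expR (2 * M) ^+ n j by rewrite exprn_gt0 ?expR_gt0.
(* The exponent [N j = (j + 2) n j] exceeds the [j * n j] of the growth comparison. *)
have HN : 864 * B / k * (n j)%:R * expR (2 * M) ^+ n j < 2 ^+ N j.
  apply: (lt_le_trans H); rewrite ler_eXn2l ?ltr1n //.
  by rewrite /N /beta_exponent leq_mul2r -addn2 leq_addr orbT.
have x2 : `|x j| ^+ 2 <= 9 * (2 ^- N j) ^+ 2.
  have -> : 9 * (2 ^- N j) ^+ 2 = (3 * (2 : R) ^- N j) ^+ 2.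
    by rewrite exprMn; congr (_ * _); ring.
  by rewrite ler_sqr ?nnegrE // mulr_ge0 // invr_ge0 ltW.
set F := `|_ - _ - _| in Hup *.
have F9 : F <= B * (9 * (2 ^- N j) ^+ 2).
  by apply: (le_trans Hup); rewrite ler_pM2l.
rewrite expRN exprVn.
apply: (@le_lt_trans _ _ (6 * 2 ^+ N j * (n j)%:R * (B * (9 * (2 ^- N j) ^+ 2)))).
  by rewrite ler_pM2l // !mulr_gt0.
move: P0 n0 E0 HN; move: (2 ^+ N j) (n j)%:R (expR (2 * M) ^+ n j) => P m E P0 n0 E0 HN.
(* Both sides are written as multiples of [k / (16 P E)], so that the comparison reduces to [HN]. *)
have -> : 6 * P * m * (B * (9 * P^-1 ^+ 2))
  = (864 * B / k * m * E) * (k / (16 * P * E)).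
  by field; rewrite !gt_eqF.
have -> : k / 16 / E = P * (k / (16 * P * E)) by field; rewrite !gt_eqF.
by rewrite ltr_pM2r // divr_gt0 // !mulr_gt0.
Qed.
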